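(* Let $M$ be a wide-sense stationary quasicrystal on $\mathbb R^d$, that is, a wide-sense stationary $L^2$ random measure whose spectral measure $\mathsf S$ is purely atomic. Then $M$ is (linearly) maximally rigid on every bounded measurable set $A\subset\mathbb R^d$.
   Context: $\mathcal C_c^b(\mathbb R^d)$ is the space of bounded measurable compactly supported functions on $\mathbb R^d$, $\mathcal C_c^b(A^c)$ the subspace of those vanishing on $A$, and $\hat f(u)=\int e^{-i\langle u,x\rangle}f(x)\,dx$. Wide-sense stationary (WSS) $L^2$ random (signed) measure $M$: a linear family of real $L^2$ random variables $I_M(f)$, $f\in\mathcal C_c^b(\mathbb R^d)$ real (extended linearly to complex $f$), such that $\mathrm{Var}(I_M(f))$ is invariant under translations of $f$ and $\mathrm{Var}(I_M(f))=(2\pi)^{-d}\int|\hat f|^2\,d\mathsf S$ for a non-negative symmetric measure $\mathsf S$ on $\mathbb R^d$, the spectral measure. $M$ is linearly maximally rigid on $A$ if for every bounded measurable $\gamma$ supported in $A$, $\inf_{h\in\mathcal C_c^b(A^c)}\mathrm{Var}(I_M(\gamma)-I_M(h))=0$. *)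

(* Defs.v *)
From HB Require Import structures.
From mathcomp Require Import all_boot all_order all_algebra.
From mathcomp Require Import complex.
From mathcomp Require Import all_classical all_reals all_analysis.

Set Implicit Arguments.
Unset Strict Implicit.
Unset Printing Implicit Defensive.

Import Order.TTheory GRing.Theory Num.Theory.
Import numFieldNormedType.Exports.

Local Open Scope classical_set_scope.
Local Open Scope ring_scope.
Local Open Scope complex_scope.

Definition rV_display : measure_display. Proof. exact: default_measure_display. Qed.

(* The sigma-algebra generated by the coordinates, i.e. the Borel one. *)
Section rV_measurable.
Context {R : realType} (d : nat).

Definition rV_coord (i : 'I_d) (x : 'rV[R]_d) : R := x ord0 i.

Let set0P : g_sigma_preimage rV_coord set0.
Proof. exact: sigma_algebra0. Qed.

Let setCP A : g_sigma_preimage rV_coord A -> g_sigma_preimage rV_coord (~` A).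
Proof. exact: sigma_algebraC. Qed.

Let bigcupP (F : _^nat) : (forall i, g_sigma_preimage rV_coord (F i)) ->
  g_sigma_preimage rV_coord (\bigcup_i (F i)).
Proof. exact: sigma_algebra_bigcup. Qed.

HB.instance Definition _ := @isMeasurable.Build rV_display
  'rV[R]_d (g_sigma_preimage rV_coord) set0P setCP bigcupP.

End rV_measurable.

Section rV_measurable_lemmas.
Context {R : realType}.

Lemma measurable_rV_coord d (i : 'I_d) :
  measurable_fun [set: 'rV[R]_d] (@rV_coord R d i).
Proof.
move=> _ Y mY; rewrite setTI; apply: sub_sigma_algebra => /=.
rewrite -bigcup_seq/=; exists i => /=; first by rewrite mem_index_enum.
by exists Y => //; rewrite setTI.
Qed.

Lemma measurable_fun_rVP dT (T : measurableType dT) d (f : T -> 'rV[R]_d) :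
  (forall i, measurable_fun [set: T] (fun x => f x ord0 i)) ->
  measurable_fun [set: T] f.
Proof.
move=> mf _ Y; rewrite setTI; move: Y.
pose G := [set Y | measurable (f @^-1` Y)].
have sG : sigma_algebra [set: 'rV[R]_d] G.
  split; rewrite /G /=.
  - by rewrite preimage_set0.
  - by move=> A mA; rewrite setTD preimage_setC; exact: measurableC.
  - by move=> F mF; rewrite preimage_bigcup; exact: bigcupT_measurable.
apply: (@smallest_sub _ _ _ G) => // Y.
rewrite -bigcup_seq/= => -[i _] [B mB <-]; rewrite setTI /G /=.
by have := mf i measurableT B mB; rewrite setTI.
Qed.

Definition rV_cons d (p : R * 'rV[R]_d) : 'rV[R]_d.+1 :=
  \row_(i < d.+1) (if unlift ord0 i is Some j then p.2 ord0 j else p.1).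

Lemma measurable_rV_cons d : measurable_fun setT (@rV_cons d).
Proof.
apply: measurable_fun_rVP => i.
case: (unliftP ord0 i) => [j|] ->.
  rewrite (_ : (fun _ => _) = rV_coord j \o snd).
    apply: measurableT_comp; last exact: measurable_snd.
    exact: measurable_rV_coord.
  by apply/funext => x; rewrite mxE liftK.
rewrite (_ : (fun _ => _) = fst); first exact: measurable_fst.
by apply/funext => x; rewrite mxE unlift_none.
Qed.

Definition rV_uncons d (x : 'rV[R]_d.+1) : R * 'rV[R]_d :=
  (x ord0 ord0, \row_(j < d) x ord0 (lift ord0 j)).

Lemma rV_consK d : cancel (@rV_cons d) (@rV_uncons d).
Proof.
move=> [a x]; rewrite /rV_uncons mxE unlift_none; congr pair.
by apply/rowP => j; rewrite !mxE liftK.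
Qed.

Lemma measurable_rV_uncons d : measurable_fun setT (@rV_uncons d).
Proof.
apply: measurable_fun_pair; first exact: measurable_rV_coord.
apply: measurable_fun_rVP => j.
rewrite (_ : (fun _ => _) = rV_coord (lift ord0 j)).
  exact: measurable_rV_coord.
by apply/funext => x; rewrite mxE.
Qed.

End rV_measurable_lemmas.

(* Lebesgue measure on R^d, as the d-fold product of Lebesgue measure on R:    *)
(* a unit mass on R^0, then R^d.+1 identified with R * R^d.                    *)
Section lebesgue_rV.
Context {R : realType}.
Local Open Scope ereal_scope.

Section step.
Variables (d : nat) (m : {sigma_finite_measure set 'rV[R]_d -> \bar R}).

Definition lebesgue_rV_step : set 'rV[R]_d.+1 -> \bar R :=
  pushforward ((@lebesgue_measure R) \x m) (@rV_cons R d).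

Let step0 : lebesgue_rV_step set0 = 0.
Proof. by rewrite /lebesgue_rV_step /pushforward preimage_set0 measure0. Qed.

Let step_ge0 A : 0 <= lebesgue_rV_step A.
Proof. by rewrite /lebesgue_rV_step /pushforward; apply: measure_ge0. Qed.

Let step_sigma_additive : semi_sigma_additive lebesgue_rV_step.
Proof.
have mc A : measurable A -> measurable (@rV_cons R d @^-1` A).
  by move=> mA; rewrite -[X in measurable X]setTI; exact: measurable_rV_cons.
move=> F mF tF mUF; rewrite /lebesgue_rV_step /pushforward preimage_bigcup.
apply: measure_semi_sigma_additive; first by move=> n; exact: mc.
  apply/trivIsetP => /= i j _ _ ij; rewrite -preimage_setI.
  by move/trivIsetP : tF => /(_ _ _ _ _ ij) -> //; rewrite preimage_set0.
by rewrite -preimage_bigcup; exact: mc.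
Qed.

HB.instance Definition _ := isMeasure.Build _ _ _ lebesgue_rV_step
  step0 step_ge0 step_sigma_additive.

(* Reproved for products because the canonical instance on m1 \x m2 is only    *)
(* found when m1 and m2 are subprobabilities.                                  *)
Let step_sigma_finite : sigma_finite setT lebesgue_rV_step.
Proof.
have [F FT Foo] : sigma_finite setT ((@lebesgue_measure R) \x m).
  have /sigma_finiteP[F [TF ndF Foo]] := sigma_finiteT (@lebesgue_measure R).
  have /sigma_finiteP[G [TG ndG Goo]] := sigma_finiteT m.
  exists (fun n => F n `*` G n).
    rewrite -setXTT TF TG predeqE => -[x y]; split.
      move=> [/= [n _ Fnx] [k _ Gky]]; exists (maxn n k) => //; split.
      - by move: x Fnx; exact/subsetPset/ndF/leq_maxl.
      - by move: y Gky; exact/subsetPset/ndG/leq_maxr.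
    by move=> [n _ []/= ? ?]; split; exists n.
  move=> k; have [? ?] := Foo k; have [? ?] := Goo k.
  split; first exact: measurableX.
  by rewrite product_measure1E// lte_mul_pinfty// ge0_fin_numE.
exists (fun n => @rV_uncons R d @^-1` F n).
  by rewrite -preimage_bigcup -FT preimage_setT.
move=> n; have [mF Fn] := Foo n; split.
  by rewrite -[X in measurable X]setTI; exact: measurable_rV_uncons.
rewrite /lebesgue_rV_step /pushforward -comp_preimage.
rewrite (_ : _ \o _ = id) ?preimage_id//.
by apply/funext => x /=; rewrite rV_consK.
Qed.

HB.instance Definition _ := Measure_isSigmaFinite.Build _ _ _
  lebesgue_rV_step step_sigma_finite.

End step.

Fixpoint lebesgue_rV (d : nat) : {sigma_finite_measure set 'rV[R]_d -> \bar R} :=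
  match d with
  | 0%N => \d_(0%R : 'rV[R]_0)
  | d'.+1 => lebesgue_rV_step (lebesgue_rV d')
  end.

Lemma lebesgue_rV_box (d : nat) (A : 'I_d -> set R) :
  (forall i, measurable (A i)) ->
  lebesgue_rV d [set x | forall i, A i (x ord0 i)] =
  \prod_(i < d) (@lebesgue_measure R) (A i).
Proof.
elim: d A => [|d IHd] A mA /=.
  rewrite big_ord0 diracE mem_set//=; first by case.
have mbox : measurable [set x : 'rV[R]_d | forall i, A (lift ord0 i) (x ord0 i)].
  rewrite (_ : mkset _ = \bigcap_(i in [set: 'I_d])
      rV_coord i @^-1` (A (lift ord0 i))).
    apply: fin_bigcap_measurable => // i _.
    by rewrite -[X in measurable X]setTI; exact: measurable_rV_coord.
  by apply/seteqP; split => [x h i _|x h i]; [exact: h|exact: (h i)].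
rewrite big_ord_recl -(IHd (fun i => A (lift ord0 i)))//.
rewrite -product_measure1E//; last exact: mA.
rewrite /lebesgue_rV_step /pushforward.
congr product_measure1; apply/seteqP; split => -[a x] /=.
  move=> h; split.
    by have := h ord0; rewrite mxE unlift_none.
  by move=> i; have := h (lift ord0 i); rewrite mxE liftK.
by move=> [Aa Ax] i; rewrite mxE; case: unliftP => [j|] ->.
Qed.

End lebesgue_rV.

Section complex_functions.
Context {R : realType}.

Definition measurable_cfun {dT} {T : measurableType dT} (f : T -> R[i]) :=
  measurable_fun [set: T] (fun x => complex.Re (f x)) /\
  measurable_fun [set: T] (fun x => complex.Im (f x)).

Definition bounded_cfun {T : Type} (f : T -> R[i]) :=
  exists c : R, forall x, ComplexField.Normc.normc (f x) <= c.

Definition cintegral {dT} {T : measurableType dT}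
    (mu : {measure set T -> \bar R}) (f : T -> R[i]) : R[i] :=
  (\int[mu]_x complex.Re (f x)) +i* (\int[mu]_x complex.Im (f x)).

Definition cexpi (t : R) : R[i] := cos t +i* sin t.

(* E |Z - E Z|^2 *)
Definition cvariance {dT} {T : measurableType dT} (P : probability T R)
    (Z : T -> R[i]) : \bar R :=
  ('V_P[fun w => complex.Re (Z w)] + 'V_P[fun w => complex.Im (Z w)])%E.

Context {d : nat}.
Implicit Types (f : 'rV[R]_d -> R[i]) (x u : 'rV[R]_d).

Definition Ccb f := [/\ measurable_cfun f, bounded_cfun f &
  compact (closure [set x | f x != 0])].

Definition fourier f u : R[i] :=
  cintegral (lebesgue_rV d)
    (fun x => cexpi (- (\sum_(i < d) u ord0 i * x ord0 i)) * f x).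

End complex_functions.

(* Random variables in L^2 are only meaningful up to almost sure equality,     *)
(* hence the almost sure linearity. The values of RMint outside bounded        *)
(* measurable compactly supported functions are irrelevant.                    *)
Record L2RandomMeasure {R : realType} {dO : measure_display}
    {Omega : measurableType dO} (P : probability Omega R) (d : nat) := {
  RMint :> ('rV[R]_d -> R) -> Omega -> R ;
  RMint_L2 : forall f, Ccb (fun x => (f x)%:C) -> RMint f \in Lfun P 2%:E ;
  RMint_linear : forall (a : R) (f g : 'rV[R]_d -> R),
    Ccb (fun x => (f x)%:C) -> Ccb (fun x => (g x)%:C) ->
    {ae P, forall w,
      RMint (fun x => a * f x + g x) w = a * RMint f w + RMint g w} }.

Section wide_sense_stationary.
Context {R : realType} {dO : measure_display} {Omega : measurableType dO}
  {P : probability Omega R} {d : nat}.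
Implicit Types (M : L2RandomMeasure P d) (S : {measure set 'rV[R]_d -> \bar R}).

(* The linear extension of I_M to complex functions. *)
Definition RMcint M (f : 'rV[R]_d -> R[i]) (w : Omega) : R[i] :=
  (M (fun x => complex.Re (f x)) w) +i* (M (fun x => complex.Im (f x)) w).

Definition symmetric_measure S :=
  forall B : set 'rV[R]_d, measurable B -> S (-%R @^-1` B) = S B.

Definition is_spectral_measure M S :=
  symmetric_measure S /\
  forall f, Ccb f -> cvariance P (RMcint M f) =
    (((2 * pi) ^- d)%:E *
      \int[S]_u ((ComplexField.Normc.normc (fourier f u)) ^+ 2)%:E)%E.

Definition wide_sense_stationary M :=
  (forall f t, Ccb f ->
    cvariance P (RMcint M (fun x => f (x - t))) = cvariance P (RMcint M f)) /\
  exists S, is_spectral_measure M S.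

(* S is the sum over u of S {u} times the Dirac mass at u. *)
Definition purely_atomic S :=
  forall B : set 'rV[R]_d, measurable B -> S B = \esum_(u in B) S [set u].

Definition wss_quasicrystal M :=
  wide_sense_stationary M /\
  exists S, is_spectral_measure M S /\ purely_atomic S.

Definition linearly_maximally_rigid M (A : set 'rV[R]_d) :=
  forall gamma : 'rV[R]_d -> R[i],
    measurable_cfun gamma -> bounded_cfun gamma ->
    (forall x, ~ A x -> gamma x = 0) ->
    ereal_inf [set cvariance P (fun w => RMcint M gamma w - RMcint M h w) |
      h in [set h | Ccb h /\ forall x, A x -> h x = 0]] = 0%E.

End wide_sense_stationary.

(* Main.v *)
Require Import Defs.
From HB Require Import structures.
From mathcomp Require Import all_boot all_order all_algebra.
From mathcomp Require Import complex finmap.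
From mathcomp Require Import all_classical all_reals all_analysis measurable_realfun.
From mathcomp Require Import ring lra.

Import Order.TTheory GRing.Theory Num.Theory.
Import numFieldNormedType.Exports.

Local Open Scope classical_set_scope.
Local Open Scope ring_scope.

(** The random measure is compared with its own translates. For a test function
    [g] vanishing outside the bounded set [A], take [h = g (. - t)] with [t] so
    large that [h] vanishes on [A]. Translation multiplies the Fourier transform
    by a phase (lemma [fourier_increment]), so the prediction error is
    [[
      (2 pi)^-d  int |1 - exp (-i <u, t>)|^2 |hat g (u)|^2 dS(u).
    ]]
    Since [S] is purely atomic, this integral is the sum over the points [u] of
    [|1 - exp (-i <u, t>)|^2 a u], where [a u = |hat g (u)|^2 S {u}] has a finite
    sum, namely the variance of the integral of [g] up to a constant. All but a
    small part of that sum is carried by finitely many points (lemma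
    [esum_attenuated]); there the phases have to be nearly 1, while elsewhere the
    bound [|1 - exp (-i <u, t>)|^2 <= 4] is enough. Dirichlet's pigeonhole argument
    (lemma [simultaneous_recurrence]), applied to the multiples of a translation
    along the first axis longer than the diameter of [A], makes those finitely
    many phases simultaneously close to 1. In other words the integrals of the
    translates of [g] are almost periodic in mean square, so that the integral of
    [g] is known approximately from that of a distant translate. *)

(** * Simultaneous recurrence of finitely many rotations *)

Lemma truncn_near (R : realType) (N : nat) (x y : R) : -1 <= x -> -1 <= y ->
  Num.truncn (N.+1%:R * (x + 1)) = Num.truncn (N.+1%:R * (y + 1)) ->
  `|x - y| <= N.+1%:R^-1.
Proof.
move=> x1 y1 exy.
have N0 : 0 < N.+1%:R :> R by rewrite ltr0n.
have tx : 0 <= N.+1%:R * (x + 1) by rewrite mulr_ge0 ?(ltW N0)//; lra.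
have ty : 0 <= N.+1%:R * (y + 1) by rewrite mulr_ge0 ?(ltW N0)//; lra.
have /andP[lx ux] := truncn_itv tx; have /andP[ly uy] := truncn_itv ty.
rewrite exy -[(Num.truncn _).+1%:R]natr1 in lx ux.
rewrite -[(Num.truncn _).+1%:R]natr1 in uy.
rewrite -[leLHS](mulKf (lt0r_neq0 N0)) -[leRHS]mulr1 ler_pM2l ?invr_gt0//.
rewrite -[X in X * _](gtr0_norm N0) -normrM ler_norml; apply/andP; split; lra.
Qed.

(** Dirichlet's argument. Cut the square [[-1, 1]^2] into a grid of mesh
    [1 / N.+1]. Among more multiples of the angles than there are assignments of
    cells to the indices, two put every point [(cos, sin)] into the same cell;
    their difference is the required [n], because
    [2 - 2 cos (x - y) = (cos x - cos y)^2 + (sin x - sin y)^2]. *)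
Lemma simultaneous_recurrence (R : realType) (I : eqType) (s : seq I)
    (theta : I -> R) (e : R) : 0 < e ->
  exists n, (0 < n)%N /\
    forall i, i \in s -> 2 - 2 * cos (n%:R * theta i) <= e.
Proof.
(* Two coordinates within [1 / N.+1] of each other contribute at most
   [2 / N.+1 ^ 2 <= 2 / N.+1 <= e]. *)
move=> e0; pose N := Num.truncn (2 / e).
have Ne : 2 / N.+1%:R <= e.
  rewrite ler_pdivrMr ?ltr0n// mulrC -ler_pdivrMr//.
  by apply/ltW; rewrite truncnS_gt.
pose cell (x : R) : 'I_(2 * N.+1).+1 := inord (Num.truncn (N.+1%:R * (x + 1))).
have cell_lt (x : R) : x <= 1 -> (Num.truncn (N.+1%:R * (x + 1)) < (2 * N.+1).+1)%N.
  move=> x1; rewrite ltnS -[leqRHS](@natrK R) le_truncn// natrM mulrC.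
  rewrite ler_wpM2r ?ler0n//; lra.
have cell_near (x y : R) : -1 <= x -> -1 <= y -> x <= 1 -> y <= 1 ->
    cell x = cell y -> `|x - y| <= N.+1%:R^-1.
  move=> x1 y1 x2 y2 /(congr1 val); rewrite /= !inordK ?cell_lt//.
  exact: truncn_near.
pose T := {ffun 'I_(size s) -> 'I_(2 * N.+1).+1 * 'I_(2 * N.+1).+1}.
pose th (k : 'I_(size s)) := theta (tnth (in_tuple s) k).
pose phi (m : 'I_#|T|.+1) : T :=
  [ffun k => (cell (cos (m%:R * th k)), cell (sin (m%:R * th k)))].
have /injectivePn[m [p + phimp]] : ~~ injectiveb phi.
  by apply/injectiveP => /leq_card; rewrite card_ord ltnn.
wlog mp : m p phimp / (m < p)%N => [hw mp|_].
  have [lmp|] := ltnP m p; first exact: (hw m p).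
  rewrite leq_eqVlt => /orP[/eqP/val_inj pm|lpm]; first by rewrite pm eqxx in mp.
  by apply: (hw p m) => //; rewrite eq_sym.
exists (p - m)%N; split; first by rewrite subn_gt0.
move=> i si; have /tnthP[k ->] : i \in in_tuple s by [].
rewrite -/(th k).
have := congr1 (fun f : T => f k) phimp; rewrite !ffunE => -[cc ss].
have dc := cell_near _ _ (cos_geN1 _) (cos_geN1 _) (cos_le1 _) (cos_le1 _) cc.
have ds := cell_near _ _ (sin_geN1 _) (sin_geN1 _) (sin_le1 _) (sin_le1 _) ss.
rewrite natrB ?(ltnW mp)// mulrBl cosB.
have cp := cos2Dsin2 (p%:R * th k); have cm := cos2Dsin2 (m%:R * th k).
have N1 : N.+1%:R^-1 <= 1 :> R by rewrite invf_le1 ?ltr0n// ler1n.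
have N0 : 0 < N.+1%:R^-1 :> R by rewrite invr_gt0 ltr0n.
have sq (x : R) : `|x| <= N.+1%:R^-1 -> x ^+ 2 <= N.+1%:R^-1 ^+ 2.
  by move=> xN; rewrite -real_normK ?num_real// lerXn2r ?nnegrE// ltW.
move: N1 N0 (sq _ dc) (sq _ ds) cp cm Ne; set v := _^-1.
set a := cos _; set b := cos _; set c := sin _; set d := sin _.
move=> *; nra.
Qed.

(** * Integration against a purely atomic measure *)

Lemma measurable_rV_set1 (R : realType) (d : nat) (u : 'rV[R]_d) :
  measurable [set u].
Proof.
rewrite (_ : [set u] = \bigcap_(i in [set: 'I_d]) rV_coord i @^-1` [set u ord0 i]).
  apply: fin_bigcap_measurable => // i _.
  rewrite -[X in measurable X]setTI; exact: measurable_rV_coord.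
apply/seteqP; split => [x -> i _ //|x h].
by apply/rowP => i; exact: (h i).
Qed.

Section purely_atomic_integral.
Local Open Scope ereal_scope.
Import HBNNSimple.

Lemma esumZl (R : realType) (T : choiceType) (I : set T) (r : R)
    (a : T -> \bar R) : (0 <= r)%R -> (forall i, I i -> 0 <= a i) ->
  \esum_(i in I) (r%:E * a i) = r%:E * \esum_(i in I) a i.
Proof.
move=> r0 a0.
have le s (b : T -> \bar R) : (0 <= s)%R -> (forall i, I i -> 0 <= b i) ->
    \esum_(i in I) (s%:E * b i) <= s%:E * \esum_(i in I) b i.
  move=> s0 b0; apply: ge_ereal_sup => _ [X [finX XI] <-].
  rewrite [X in X <= _](_ : _ = s%:E * \sum_(x \in X) b x); last first.
    rewrite fsbig_finite//= [in RHS]fsbig_finite//= big_seq [in RHS]big_seq.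
    rewrite ge0_sume_distrr// => i.
    by rewrite in_fset_set// inE => /XI/b0.
  rewrite lee_wpmul2l ?lee_fin//; apply: ereal_sup_ubound; by exists X.
apply/eqP; rewrite eq_le le//=.
have [->|rn0] := eqVneq r 0%R.
  by rewrite mul0e esum_ge0// => i _; rewrite mul0e.
have {rn0}r0 : (0 < r)%R by rewrite lt0r rn0.
rewrite -lee_pdivlMl//.
have ra0 i : I i -> 0 <= r%:E * a i.
  by move=> Ii; rewrite mule_ge0 ?a0// lee_fin ltW.
apply: le_trans (le r^-1%R _ _ ra0); last by rewrite invr_ge0 ltW.
apply: le_esum => i _; by rewrite muleA -EFinM mulVf ?gt_eqF// mul1e.
Qed.

(** Atomicity turns the measure of each level set of [h] into a sum over its
    points, and every point lies in exactly one level set. *)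
Lemma purely_atomic_sintegral (R : realType) (d : nat)
    (S : {measure set 'rV[R]_d -> \bar R}) (h : {nnsfun 'rV[R]_d >-> R}) :
  purely_atomic S -> sintegral S h = \esum_(u in setT) (h u)%:E * S [set u].
Proof.
move=> pS; rewrite sintegralE.
transitivity (\sum_(y \in range h)
    \esum_(u in setT) (if u \in h @^-1` [set y] then (h u)%:E * S [set u] else 0)).
  apply: eq_fsbigr => y /[!inE] -[v _ hv].
  rewrite -esum_mkcondr setTI pS; last first.
    exact: measurable_sfunP.
  rewrite -esumZl//; last by rewrite -hv.
  by apply: eq_esum => u /= ->.
rewrite fsbig_finite//=.
rewrite -esum_sum; last first.
  by move=> u y _ _; case: ifP => // _; rewrite mule_ge0 ?lee_fin.
apply: eq_esum => u _.
have hu : h u \in fset_set (range h).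
  by rewrite in_fset_set// mem_set//; exists u.
rewrite (bigD1_seq _ hu (fset_uniq _))/=.
rewrite mem_set// big1 ?adde0// => y /negP yhu; rewrite memNset//= => huy.
by apply: yhu; rewrite huy.
Qed.

(** The integral of a nonnegative function is the supremum of the integrals of
    the simple functions below it. Cutting any [g] off outside a finite set
    gives a simple function, so the equality reaches arbitrary [g], in
    particular squared moduli of Fourier transforms. *)
Lemma integral_purely_atomic (R : realType) (d : nat)
    (S : {measure set 'rV[R]_d -> \bar R}) (g : 'rV[R]_d -> R) :
  purely_atomic S -> (forall u, 0 <= g u)%R ->
  \int[S]_u (g u)%:E = \esum_(u in setT) (g u)%:E * S [set u].
Proof.
move=> pS g0; have g0' u : 0 <= (g u)%:E by rewrite lee_fin.
apply/eqP; rewrite eq_le; apply/andP; split.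
  rewrite ge0_integralTE//; apply: ge_ereal_sup => _ [h /= hg <-].
  rewrite purely_atomic_sintegral//; apply: le_esum => u _.
  by rewrite lee_wpmul2r.
apply: ge_ereal_sup => _ [F [finF _] <-].
(* [gF] is [g] cut off outside [F]. *)
pose gF u := \sum_(v <- fset_set F) (g v)%:E * (\1_[set v] u)%:E.
have gF0 v u : 0 <= (g v)%:E * (\1_[set v] u)%:E by rewrite mule_ge0 ?lee_fin.
have gFg u : gF u <= (g u)%:E.
  rewrite /gF; have [uF|uF] := boolP (u \in fset_set F).
    rewrite (bigD1_seq _ uF (fset_uniq _))/= big1 ?adde0.
      by rewrite indicE mem_set// mule1.
    by move=> v /negP vu; rewrite indicE memNset ?mule0// => uv; apply: vu; rewrite uv.
  rewrite big_seq big1// => v vF; rewrite indicE memNset ?mule0//= => uv.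
  by move: uF; rewrite uv vF.
apply: (@le_trans _ _ (\int[S]_u gF u)); last first.
  rewrite !ge0_integralTE//; last by move=> u; rewrite sume_ge0.
  apply: le_ereal_sup => _ [h /= hg <-]; exists h => // u.
  exact: le_trans (hg u) (gFg u).
rewrite ge0_integral_sum//; last first.
  move=> v; apply: measurable_funeM; apply/measurable_EFinP.
  by apply: measurable_indic; exact: measurable_rV_set1.
rewrite fsbig_finite//=; apply: lee_sum => v _.
have mv : measurable_fun setT (fun u => (\1_[set v] u)%:E : \bar R).
  by apply/measurable_EFinP; apply: measurable_indic; exact: measurable_rV_set1.
rewrite ge0_integralZl//.
by rewrite integral_indic ?setIT//; exact: measurable_rV_set1.
Qed.

End purely_atomic_integral.

(** Weights bounded by [C] that are small on a suitable finite set make a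
    convergent sum small; the finite set depends on [e] and [C], but not on the
    weights. *)
Lemma esum_attenuated (R : realType) (T : choiceType) (a : T -> \bar R) (e C : R) :
  (forall u, 0 <= a u)%E -> (\esum_(u in setT) a u < +oo)%E -> 0 < e -> 0 < C ->
  exists (F : seq T) (delta : R), 0 < delta /\
    forall w : T -> R, (forall u, 0 <= w u <= C) ->
      (forall u, u \in F -> w u <= delta) ->
      (\esum_(u in setT) (w u)%:E * a u <= e%:E)%E.
Proof.
move=> a0 aoo e0 C0.
have [E Ea] : exists E : R, (\esum_(u in setT) a u = E%:E)%E.
  exists (fine (\esum_(u in setT) a u)%E); rewrite fineK// ge0_fin_numE//.
  exact: esum_ge0.
have E0 : 0 <= E by rewrite -lee_fin -Ea esum_ge0.
(* Half of [e] pays for the tail outside [X], where the weights are at most [C],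
   and half for [X], where they are at most [e / (2 * (E + 1))]; the [+ 1]
   covers [E = 0]. *)
have e2C : 0 < e / (2 * C) by rewrite divr_gt0// mulr_gt0.
have : ((E - e / (2 * C))%:E < \esum_(u in setT) a u)%E.
  by rewrite Ea lte_fin ltrBlDr ltrDl.
move=> /ereal_sup_gt[_ [X [finX _] <-]]; rewrite -esum_fset// => aX.
have delta0 : 0 < e / (2 * (E + 1)) by rewrite divr_gt0// mulr_gt0// ltr_wpDl.
exists (fset_set X), (e / (2 * (E + 1))); split => //.
move=> w wC wX.
have aE := esumID X setT a (fun u _ => a0 u).
rewrite !setTI Ea in aE.
have aXE : (\esum_(u in X) a u <= E%:E)%E.
  by rewrite aE leeDl// esum_ge0.
have aCX : (\esum_(u in ~` X) a u <= (e / (2 * C))%:E)%E.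
  have : (\esum_(u in X) a u \is a fin_num)%E.
    by rewrite ge0_fin_numE ?esum_ge0// (le_lt_trans aXE)// ltry.
  have : (\esum_(u in ~` X) a u \is a fin_num)%E.
    rewrite ge0_fin_numE ?esum_ge0// (@le_lt_trans _ _ E%:E)// ?ltry//.
    by rewrite aE leeDr// esum_ge0.
  move: aX aE; case: esum => // x; case: esum => // y.
  rewrite lte_fin -EFinD => xE [Exy] _ _; rewrite lee_fin; lra.
rewrite (esumID X setT)/=; last by move=> u _; rewrite mule_ge0// lee_fin; have /andP[] := wC u.
rewrite !setTI.
apply: (@le_trans _ _ ((e / (2 * (E + 1)))%:E * (\esum_(u in X) a u)
    + C%:E * (\esum_(u in ~` X) a u))%E).
  rewrite -!esumZl ?(ltW C0) ?(ltW delta0)//.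
  apply: leeD; apply: le_esum => u Xu; rewrite lee_wpmul2r// lee_fin.
    by apply: wX; rewrite in_fset_set// inE.
  by have /andP[] := wC u.
apply: (@le_trans _ _ ((e / (2 * (E + 1)))%:E * E%:E + C%:E * (e / (2 * C))%:E)%E).
  by apply: leeD; rewrite lee_pmul2l// lte_fin.
rewrite -!EFinM -EFinD lee_fin.
rewrite (_ : C * (e / (2 * C)) = e / 2); last by field; rewrite gt_eqF.
rewrite (_ : e / (2 * (E + 1)) * E = e / 2 * (E / (E + 1))); last first.
  by field; rewrite gt_eqF// ltr_wpDl.
have : E / (E + 1) <= 1 by rewrite ler_pdivrMr ?ltr_wpDl// mul1r lerDl.
nra.
Qed.

(** * Translation invariance of Lebesgue measure *)

Lemma lebesgue_measure_translation (R : realType) (t : R) (A : set R) :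
  measurable A ->
  lebesgue_measure ((fun x : R => x + t) @^-1` A) = lebesgue_measure A.
Proof.
have mt : measurable_fun [set: R] (fun x : R => x + t).
  exact: measurable_funD.
move=> mA; apply/esym.
have := @lebesgue_measure_unique R (pushforward lebesgue_measure
  ((fun x : R => x + t) : _ -> measurableTypeR R)).
apply => // _ [[a b]] _ <-.
rewrite -[RHS]/(lebesgue_measure ((fun x : R => x + t) @^-1` `]a, b]%classic)).
rewrite (_ : _ @^-1` _ = `]a - t, b - t]%classic); last first.
  by apply/seteqP; split => x /=; rewrite !in_itv/= ltrBlDr lerBrDr.
rewrite /= !lebesgue_measure_itv/= !lte_fin ltrD2r -!EFinD.
by rewrite (_ : b - t - (a - t) = b - a)//; ring.
Qed.

Lemma rV_consD (R : realType) (d : nat) (a : R) (x : 'rV[R]_d)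
    (t : 'rV[R]_d.+1) :
  rV_cons (a, x) + t =
  rV_cons (a + t ord0 ord0, x + \row_(j < d) t ord0 (lift ord0 j)).
Proof.
apply/rowP => i; rewrite !mxE.
by case: (unliftP ord0 i) => [j|] -> //; rewrite !mxE.
Qed.

Lemma measurable_rV_translation (R : realType) (d : nat) (t : 'rV[R]_d) :
  measurable_fun [set: 'rV[R]_d] (fun x : 'rV[R]_d => x + t).
Proof.
apply: measurable_fun_rVP => i.
rewrite (_ : (fun _ => _) = (fun x => rV_coord i x + t ord0 i)).
  by apply: measurable_funD => //; exact: measurable_rV_coord.
by apply/funext => x; rewrite mxE.
Qed.

Section translation_rV.
Local Open Scope ereal_scope.

(** By induction on the dimension: the sections of a translated set are
    translates of the sections of the set at a translated first coordinate. *)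
Lemma lebesgue_rV_translation (R : realType) (d : nat) (t : 'rV[R]_d)
    (A : set 'rV[R]_d) : measurable A ->
  lebesgue_rV d ((fun x => (x + t)%R) @^-1` A) = lebesgue_rV d A.
Proof.
elim: d t A => [|d IHd] t A mA.
  rewrite (_ : _ @^-1` _ = A)//.
  by apply/seteqP; split => x /=; rewrite (_ : (x + t)%R = x)//; apply/rowP => -[].
have mc (B : set 'rV[R]_d.+1) : measurable B -> measurable (@rV_cons R d @^-1` B).
  by move=> mB; rewrite -[X in measurable X]setTI; exact: measurable_rV_cons.
rewrite /= /lebesgue_rV_step /pushforward.
set B := @rV_cons R d @^-1` A.
have mB : measurable B by exact: mc.
pose t' := \row_(j < d) t ord0 (lift ord0 j) : 'rV[R]_d.
rewrite /product_measure1/=.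
pose G a := lebesgue_rV d (xsection B a).
have mG : measurable_fun [set: measurableTypeR R] G.
  exact: measurable_fun_xsection.
transitivity (\int[lebesgue_measure]_a G (a + t ord0 ord0)%R).
  apply: eq_integral => a _; rewrite /G -[RHS](IHd t'); last first.
    exact: measurable_xsection.
  congr (lebesgue_rV d _); apply/funext => x; apply/propext.
  by rewrite /xsection /= !inE /B /= rV_consD.
have mt : measurable_fun [set: measurableTypeR R]
    (fun x => (x + t ord0 ord0)%R : measurableTypeR R).
  exact: measurable_funD.
transitivity (\int[pushforward lebesgue_measure
  ((fun x : R => x + t ord0 ord0)%R : measurableTypeR R -> measurableTypeR R)]_a G a).
  by rewrite ge0_integral_pushforward//.
apply: eq_measure_integral => Y mY _.
exact: lebesgue_measure_translation.
Qed.

End translation_rV.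

(** * Bounded measurable functions with compact support *)

Lemma bounded_set_coord (R : realType) (d : nat) (A : set 'rV[R]_d) :
  bounded_set A -> exists r : R, forall x, A x -> forall i, `|x ord0 i| <= r.
Proof.
move=> [M [Mreal AM]]; exists (M + 1) => x Ax i.
apply: le_trans (AM _ _ x Ax); last by rewrite ltrDl.
by rewrite [leRHS]/Num.norm /= mx_normrE; apply/bigmax_geP; right => /=; exists (ord0, i).
Qed.

Lemma compact_closure_coord (R : realType) (d : nat) (A : set 'rV[R]_d) (r : R) :
  (forall x, A x -> forall i, `|x ord0 i| <= r) -> compact (closure A).
Proof.
move=> Ar.
pose B := [set v : 'rV[R]_d | forall i, `[- r, r]%classic (v ord0 i)].
have cB : compact B.
  apply: (@rV_compact _ _ (fun=> `[- r, r]%classic)) => _.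
  exact: segment_compact.
apply: (subclosed_compact (@closed_closure _ _) cB).
have clB : closed B by apply: compact_closed cB; exact: norm_hausdorff.
rewrite [B](closure_id _).1//; apply: closureS => x Ax i /=.
by rewrite in_itv /= -ler_norml; exact: Ar.
Qed.

Lemma normc_ge_coord (R : rcfType) (z : R[i]) :
  `|complex.Re z| <= ComplexField.Normc.normc z /\
  `|complex.Im z| <= ComplexField.Normc.normc z.
Proof.
case: z => a b /=; split; rewrite -sqrtr_sqr; apply: ler_wsqrtr;
  by rewrite ?lerDl ?lerDr sqr_ge0.
Qed.

Lemma normc_le_coord (R : rcfType) (z : R[i]) (a b : R) :
  `|complex.Re z| <= a -> `|complex.Im z| <= b -> ComplexField.Normc.normc z <= a + b.
Proof.
case: z => x y /= xa yb; rewrite (le_trans _ (lerD xa yb))//.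
rewrite -[leRHS]ger0_norm ?addr_ge0// -(sqrtr_sqr (`|x| + `|y|)); apply: ler_wsqrtr.
by rewrite sqrrD !real_normK ?num_real// lerD2r lerDl mulrn_wge0// mulr_ge0.
Qed.

(** Coordinate bounds in place of the complex modulus and of the closure of the
    support make the stability properties of [Ccb] elementary. *)
Lemma Ccb_coordP (R : realType) (d : nat) (f : 'rV[R]_d -> R[i]) :
  Ccb f <-> measurable_cfun f /\ exists c r : R,
    forall x, `|complex.Re (f x)| <= c /\ `|complex.Im (f x)| <= c /\
      (f x != 0 -> forall i, `|x ord0 i| <= r).
Proof.
split.
  move=> [mf [c fc] cf]; split => //.
  have [r fr] := bounded_set_coord _ _ _ (compact_bounded cf).
  exists c, r => x; have [re im] := normc_ge_coord _ (f x).
  split; first exact: le_trans re (fc x).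
  split; first exact: le_trans im (fc x).
  by move=> fx0; apply: fr; exact: subset_closure.
move=> [mf [c [r fcr]]]; split => //.
  by exists (c + c) => x; have [? [? _]] := fcr x; exact: normc_le_coord.
by apply: (@compact_closure_coord _ _ _ r) => x /=; have [_ [_]] := fcr x.
Qed.

Lemma Ccb_translation (R : realType) (d : nat) (f : 'rV[R]_d -> R[i])
    (t : 'rV[R]_d) : Ccb f -> Ccb (fun x => f (x - t)).
Proof.
move=> /Ccb_coordP[[mr mi] [c [r fcr]]]; apply/Ccb_coordP; split.
  split.
  - exact: (measurableT_comp mr (measurable_rV_translation _ _ _)).
  - exact: (measurableT_comp mi (measurable_rV_translation _ _ _)).
exists c, (r + \sum_i `|t ord0 i|) => x; have [? [? fx]] := fcr (x - t).
do 2 split => //; move=> /fx xr i; rewrite (le_trans (_ : _ <= `|(x - t) ord0 i| + `|t ord0 i|))//.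
  by rewrite !mxE -[X in `|X| <= _](subrK (t ord0 i)) ler_normD.
by rewrite lerD// (bigD1 i)//= lerDl sumr_ge0.
Qed.

Lemma CcbB (R : realType) (d : nat) (f g : 'rV[R]_d -> R[i]) :
  Ccb f -> Ccb g -> Ccb (fun x => f x - g x).
Proof.
move=> /Ccb_coordP[[fr fi] [c [r fcr]]] /Ccb_coordP[[gr gi] [c' [r' gcr]]].
apply/Ccb_coordP; split.
  split.
  - rewrite (_ : (fun _ => _) = (fun x => complex.Re (f x) - complex.Re (g x))).
      exact: measurable_funB.
    by apply/funext => x; rewrite raddfB.
  - rewrite (_ : (fun _ => _) = (fun x => complex.Im (f x) - complex.Im (g x))).
      exact: measurable_funB.
    by apply/funext => x; rewrite raddfB.
exists (c + c'), (Num.max r r') => x.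
have [fx1 [fx2 fx3]] := fcr x; have [gx1 [gx2 gx3]] := gcr x.
rewrite !raddfB/=; split; first by rewrite (le_trans (ler_normB _ _))// lerD.
split; first by rewrite (le_trans (ler_normB _ _))// lerD.
move=> fgx i; rewrite le_max.
have [fx0|/fx3 ->//] := eqVneq (f x) 0.
rewrite gx3 ?orbT//; apply: contra_neq fgx => ->.
by rewrite fx0 subr0.
Qed.

Lemma Ccb_Re (R : realType) (d : nat) (f : 'rV[R]_d -> R[i]) :
  Ccb f -> Ccb (fun x => (complex.Re (f x))%:C%C).
Proof.
move=> /Ccb_coordP[[fr fi] [c [r fcr]]]; apply/Ccb_coordP; split.
  by split => //=.
exists c, r => x; have [fx1 [fx2 fx3]] := fcr x; split => //=.
split; first by rewrite normr0 (le_trans _ fx1).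
by move=> fx0; apply: fx3; apply: contra_neq fx0 => ->.
Qed.

Lemma Ccb_Im (R : realType) (d : nat) (f : 'rV[R]_d -> R[i]) :
  Ccb f -> Ccb (fun x => (complex.Im (f x))%:C%C).
Proof.
move=> /Ccb_coordP[[fr fi] [c [r fcr]]]; apply/Ccb_coordP; split.
  by split => //=.
exists c, r => x; have [fx1 [fx2 fx3]] := fcr x; split => //=.
split; first by rewrite normr0 (le_trans _ fx1).
by move=> fx0; apply: fx3; apply: contra_neq fx0 => ->.
Qed.

Lemma Ccb_cexpi (R : realType) (d : nat) (f : 'rV[R]_d -> R[i])
    (u : 'rV[R]_d) : Ccb f ->
  Ccb (fun x => cexpi (- (\sum_(i < d) u ord0 i * x ord0 i)) * f x).
Proof.
move=> /Ccb_coordP[[fr fi] [c [r fcr]]].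
have mu : measurable_fun [set: 'rV[R]_d]
    (fun x : 'rV[R]_d => - \sum_(i < d) u ord0 i * x ord0 i).
  apply: measurableT_comp => //; apply: measurable_sum => i.
  by apply: measurable_funM => //; exact: measurable_rV_coord.
have mcos := measurableT_comp (continuous_measurable_fun (@continuous_cos R)) mu.
have msin := measurableT_comp (continuous_measurable_fun (@continuous_sin R)) mu.
apply/Ccb_coordP; split.
  split.
  - rewrite (_ : (fun _ => _) = (fun x : 'rV[R]_d =>
        cos (- \sum_(i < d) u ord0 i * x ord0 i) * complex.Re (f x) -
        sin (- \sum_(i < d) u ord0 i * x ord0 i) * complex.Im (f x))).
      by apply: measurable_funB; apply: measurable_funM.
    by apply/funext => x; case: (f x).
  - rewrite (_ : (fun _ => _) = (fun x : 'rV[R]_d =>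
        cos (- \sum_(i < d) u ord0 i * x ord0 i) * complex.Im (f x) +
        sin (- \sum_(i < d) u ord0 i * x ord0 i) * complex.Re (f x))).
      by apply: measurable_funD; apply: measurable_funM.
    by apply/funext => x; case: (f x).
exists (c + c), r => x; have [] := fcr x.
set s := - _.
have sc : `|cos s| <= 1 by rewrite ler_norml cos_geN1 cos_le1.
have ss : `|sin s| <= 1 by rewrite ler_norml sin_geN1 sin_le1.
have fx0 : cexpi s * f x != 0 -> f x != 0.
  by apply: contra_neq => ->; rewrite mulr0.
move: fx0; case: (f x) => a b fx0 /= ac [bc fx].
split.
  by rewrite (le_trans (ler_normB _ _))// lerD// normrM -[leRHS]mul1r ler_pM.
split; last by move=> /fx0.
by rewrite (le_trans (ler_normD _ _))// lerD// normrM -[leRHS]mul1r ler_pM.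
Qed.

(** * Complex integrals and Fourier transforms *)

Definition cintegrable {dT} {T : measurableType dT} {R : realType}
    (mu : {measure set T -> \bar R}) (f : T -> R[i]) :=
  mu.-integrable setT (EFin \o (fun x => complex.Re (f x))) /\
  mu.-integrable setT (EFin \o (fun x => complex.Im (f x))).

Lemma integrable_bounded_support (R : realType) (d : nat)
    (phi : 'rV[R]_d -> R) (c r : R) :
  measurable_fun setT phi -> (forall x, `|phi x| <= c) ->
  (forall x, phi x != 0 -> forall i, `|x ord0 i| <= r) ->
  (lebesgue_rV d).-integrable setT (EFin \o phi).
Proof.
move=> mphi phic phir.
pose B := [set x : 'rV[R]_d | forall i, `[- r, r]%classic (x ord0 i)].
have mB : measurable B.
  rewrite (_ : B = \bigcap_(i in [set: 'I_d]) rV_coord i @^-1` `[- r, r]).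
    apply: fin_bigcap_measurable => // i _.
    by rewrite -[X in measurable X]setTI; exact: measurable_rV_coord.
  by apply/seteqP; split => [x h i _|x h i]; [exact: h|exact: (h i)].
have LB : (lebesgue_rV d B < +oo)%E.
  have prod_lty (m : \bar R) : (0 <= m < +oo -> \prod_(i < d) m < +oo)%E.
    move=> m01; suff /andP[] : (0 <= \prod_(i < d) m < +oo)%E by [].
    apply: (big_ind (fun z : \bar R => 0 <= z < +oo)%E) => //.
    - by rewrite ltry lee_fin ler01.
    - move=> x y /andP[x0 xoo] /andP[y0 yoo].
      by rewrite mule_ge0//= lte_mul_pinfty// ge0_fin_numE.
  rewrite (@lebesgue_rV_box R d (fun=> `[- r, r]%classic))//.
  apply: prod_lty.
  by rewrite measure_ge0 lebesgue_measure_itv/=; case: ifP; rewrite ?ltry.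
have phiB : EFin \o phi = (EFin \o phi) \_ B.
  apply/funext => x; rewrite patchE; case: ifPn => // /negP xB.
  rewrite /=; have [-> //|/phir xr] := eqVneq (phi x) 0.
  by exfalso; apply: xB; rewrite inE => i /=; rewrite in_itv/= -ler_norml.
rewrite phiB; apply/(integrable_mkcond _ mB).
apply: measurable_bounded_integrable => //.
- exact: measurable_funTS.
- exists c; split; first exact: num_real.
  by move=> M cM x _; exact: le_trans (phic x) (ltW cM).
Qed.

Lemma Ccb_cintegrable (R : realType) (d : nat) (f : 'rV[R]_d -> R[i]) :
  Ccb f -> cintegrable (lebesgue_rV d) f.
Proof.
move=> /Ccb_coordP[[mr mi] [c [r fcr]]]; split.
- apply: (@integrable_bounded_support _ _ _ c r) => // x; have [? [? fx]] := fcr x => //.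
  by move=> Re0; apply: fx; apply: contra_neq Re0 => ->.
- apply: (@integrable_bounded_support _ _ _ c r) => // x; have [? [? fx]] := fcr x => //.
  by move=> Im0; apply: fx; apply: contra_neq Im0 => ->.
Qed.

Lemma cintegralB dT (T : measurableType dT) (R : realType)
    (mu : {measure set T -> \bar R}) (f g : T -> R[i]) :
  cintegrable mu f -> cintegrable mu g ->
  cintegral mu (fun x => f x - g x) = cintegral mu f - cintegral mu g.
Proof.
move=> [fr fi] [gr gi]; rewrite /cintegral.
under [X in (X +i* _)%C = _]eq_Rintegral do rewrite raddfB/=.
under [X in (_ +i* X)%C = _]eq_Rintegral do rewrite raddfB/=.
by rewrite !RintegralB.
Qed.

Lemma cintegralZ dT (T : measurableType dT) (R : realType)
    (mu : {measure set T -> \bar R}) (z : R[i]) (f : T -> R[i]) :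
  cintegrable mu f ->
  cintegrable mu (fun x => z * f x) /\
  cintegral mu (fun x => z * f x) = z * cintegral mu f.
Proof.
move=> [fr fi]; case: z => a b.
have rE : (fun x => complex.Re ((a +i* b)%C * f x)) =
    (fun x => a * complex.Re (f x) - b * complex.Im (f x)).
  by apply/funext => x; case: (f x).
have iE : (fun x => complex.Im ((a +i* b)%C * f x)) =
    (fun x => a * complex.Im (f x) + b * complex.Re (f x)).
  by apply/funext => x; case: (f x).
have Zint (k : R) (g : T -> R) : mu.-integrable setT (EFin \o g) ->
    mu.-integrable setT (EFin \o (fun x => k * g x)).
  move=> ig.
  rewrite (_ : EFin \o _ = (fun x => k%:E * (EFin \o g) x)%E); last exact/funext.
  exact: integrableZl.
split.
  split; [rewrite rE|rewrite iE].
  - by apply: (integrableB measurableT (Zint a _ fr) (Zint b _ fi)).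
  - by apply: (integrableD measurableT (Zint a _ fi) (Zint b _ fr)).
by rewrite /cintegral rE iE RintegralB ?RintegralD ?RintegralZl//; exact: Zint.
Qed.

Lemma cintegral_translation (R : realType) (d : nat) (f : 'rV[R]_d -> R[i])
    (t : 'rV[R]_d) : cintegrable (lebesgue_rV d) f ->
  cintegrable (lebesgue_rV d) (fun x => f (x + t)) /\
  cintegral (lebesgue_rV d) (fun x => f (x + t)) = cintegral (lebesgue_rV d) f.
Proof.
have mt := measurable_rV_translation R d t.
suff H (g : 'rV[R]_d -> R) : (lebesgue_rV d).-integrable setT (EFin \o g) ->
    (lebesgue_rV d).-integrable setT (EFin \o (fun x => g (x + t))) /\
    \int[lebesgue_rV d]_x g (x + t) = \int[lebesgue_rV d]_x g x.
  move=> [/H[rt er] /H[it ei]]; split; first by split.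
  by rewrite /cintegral er ei.
move=> ig.
have mg : measurable_fun setT (EFin \o g) by exact: measurable_int ig.
have E (k : 'rV[R]_d -> \bar R) :
    (\int[pushforward (lebesgue_rV d) (fun x => (x + t)%R)]_x k x =
     \int[lebesgue_rV d]_x k x)%E.
  apply: eq_measure_integral => // Y mY _.
  exact: lebesgue_rV_translation.
have igt : (lebesgue_rV d).-integrable setT (EFin \o (fun x => g (x + t))).
  apply/integrableP; split; first exact: (measurableT_comp mg mt).
  have /integrableP[_] := ig; rewrite -[X in (X < _)%E -> _]E.
  by rewrite ge0_integral_pushforward//; exact: measurableT_comp.
split => //.
by rewrite /Rintegral -[in RHS]E integral_pushforward.
Qed.

Lemma cexpiD (R : realType) (a b : R) : cexpi (a + b) = cexpi a * cexpi b.
Proof.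
by rewrite /cexpi cosD sinD; apply/eqP; rewrite eq_complex /= eqxx addrC eqxx.
Qed.

Lemma normc_1subcexpi (R : realType) (a : R) :
  ComplexField.Normc.normc (1 - cexpi a) ^+ 2 = 2 - 2 * cos a.
Proof.
rewrite /= sqr_sqrtr ?addr_ge0 ?sqr_ge0//.
have := cos2Dsin2 a; set c := cos a; set s := sin a => h; nra.
Qed.

(** Substituting [x + t] for [x] in the transform of [g (. - t)] pulls the phase
    [exp (-i <u, t>)] out of the integral. *)
Lemma fourier_increment (R : realType) (d : nat) (g : 'rV[R]_d -> R[i])
    (t u : 'rV[R]_d) : Ccb g ->
  fourier (fun x => g x - g (x - t)) u =
  (1 - cexpi (- \sum_(i < d) u ord0 i * t ord0 i)) * fourier g u.
Proof.
move=> cg; rewrite /fourier.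
(* [K] is the integrand of the transform of [g]. *)
pose K (x : 'rV[R]_d) := cexpi (- (\sum_(i < d) u ord0 i * x ord0 i)) * g x.
have iK : cintegrable (lebesgue_rV d) K by apply/Ccb_cintegrable/Ccb_cexpi.
have [iKt eKt] := cintegral_translation _ _ _ (- t) iK.
have [iZ eZ] := cintegralZ _ _ _ _
  (cexpi (- \sum_(i < d) u ord0 i * t ord0 i)) _ iKt.
rewrite -/K mulrBl mul1r -[in X in _ - X]eKt -eZ -cintegralB//.
congr cintegral; apply/funext => x; rewrite mulrBr; congr (_ - _).
rewrite /K mulrA -cexpiD; congr (cexpi _ * _).
rewrite -opprD -big_split/=; congr (- _); apply: eq_bigr => i _.
by rewrite !mxE; ring.
Qed.

(** * Variances of stochastic integrals *)

Lemma variance_ae_eq dT (T : measurableType dT) (R : realType)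
    (P : probability T R) (X Y : T -> R) :
  measurable_fun setT X -> measurable_fun setT Y ->
  {ae P, forall w, X w = Y w} -> 'V_P[X] = 'V_P[Y].
Proof.
move=> mX mY XY; rewrite /variance !unlock.
have EXY : ('E_P[X] = 'E_P[Y])%E.
  rewrite unlock; apply: ae_eq_integral => //; try exact/measurable_EFinP.
  by apply: filterS XY => w ->.
rewrite !unlock in EXY *; rewrite -EXY; set m := fine _.
apply: ae_eq_integral => //.
- by apply/measurable_EFinP; apply: measurable_funM; apply: measurable_funB.
- by apply/measurable_EFinP; apply: measurable_funM; apply: measurable_funB.
by apply: filterS XY => w XYw _; rewrite !fctE /= XYw.
Qed.

Lemma measurable_RMint (R : realType) dO (Omega : measurableType dO)
    (P : probability Omega R) (d : nat) (M : L2RandomMeasure P d)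
    (f : 'rV[R]_d -> R) :
  Ccb (fun x => (f x)%:C%C) -> measurable_fun setT (M f).
Proof. by move=> /(RMint_L2 M)/sub_Lfun_mfun; rewrite inE. Qed.

(** The stochastic integral is linear only almost surely, which the variance does
    not see. *)
Lemma variance_RMintB (R : realType) dO (Omega : measurableType dO)
    (P : probability Omega R) (d : nat) (M : L2RandomMeasure P d)
    (f g : 'rV[R]_d -> R) :
  Ccb (fun x => (f x)%:C%C) -> Ccb (fun x => (g x)%:C%C) ->
  'V_P[fun w => M f w - M g w] = 'V_P[M (fun x => f x - g x)].
Proof.
move=> cf cg; have cfg : Ccb (fun x => (f x - g x)%:C%C).
  rewrite (_ : (fun _ => _) = (fun x => (f x)%:C%C - (g x)%:C%C)).
    exact: CcbB.
  by apply/funext => x; rewrite raddfB.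
apply: variance_ae_eq.
- by apply: measurable_funB; exact: measurable_RMint.
- exact: measurable_RMint.
have := RMint_linear M (-1) cg cf; apply: filterS => w.
rewrite mulN1r addrC => <-; congr (M _ w).
by apply/funext => x; rewrite mulN1r addrC.
Qed.

Lemma cvariance_RMcintB (R : realType) dO (Omega : measurableType dO)
    (P : probability Omega R) (d : nat) (M : L2RandomMeasure P d)
    (f g : 'rV[R]_d -> R[i]) : Ccb f -> Ccb g ->
  cvariance P (fun w => RMcint M f w - RMcint M g w) =
  cvariance P (RMcint M (fun x => f x - g x)).
Proof.
move=> cf cg; rewrite /cvariance /=.
have -> : (fun x => complex.Re (f x - g x)) =
    (fun x => complex.Re (f x) - complex.Re (g x)).
  by apply/funext => x; rewrite raddfB.
have -> : (fun x => complex.Im (f x - g x)) =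
    (fun x => complex.Im (f x) - complex.Im (g x)).
  by apply/funext => x; rewrite raddfB.
congr (_ + _)%E; apply: variance_RMintB.
all: by [apply: Ccb_Re|apply: Ccb_Im].
Qed.

Lemma cvariance_lty (R : realType) dO (Omega : measurableType dO)
    (P : probability Omega R) (d : nat) (M : L2RandomMeasure P d)
    (f : 'rV[R]_d -> R[i]) : Ccb f -> (cvariance P (RMcint M f) < +oo)%E.
Proof.
move=> cf; rewrite /cvariance /=; apply: lte_add_pinfty.
- have := variance_fin_num (RMint_L2 M (Ccb_Re _ _ _ cf)).
  by rewrite ge0_fin_numE ?variance_ge0.
- have := variance_fin_num (RMint_L2 M (Ccb_Im _ _ _ cf)).
  by rewrite ge0_fin_numE ?variance_ge0.
Qed.

(** * Maximal rigidity *)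

Theorem corollary7 (R : realType) (d : nat) (d_gt0 : (0 < d)%N)
    (dO : measure_display) (Omega : measurableType dO)
    (P : probability Omega R) (M : L2RandomMeasure P d)
    (M_quasicrystal : wss_quasicrystal M)
    (A : set 'rV[R]_d) (mA : measurable A) (bA : bounded_set A) :
  linearly_maximally_rigid M A.
Proof.
move=> g mg bg gA.
have [r Ar] := bounded_set_coord _ _ _ bA.
have cg : Ccb g.
  split => //; apply: (@compact_closure_coord _ _ _ r) => x /= /eqP gx.
  by apply: Ar; apply: contrapT => /gA.
have [_ [S [[_ VS] atS]]] := M_quasicrystal.
pose c := (2 * pi) ^- d : R.
have c0 : 0 < c by rewrite invr_gt0 exprn_gt0// mulr_gt0// pi_gt0.
pose a u := ((ComplexField.Normc.normc (fourier g u) ^+ 2)%:E * S [set u])%E.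
have a0 u : (0 <= a u)%E by rewrite mule_ge0// lee_fin sqr_ge0.
(* Up to the factor [c] this sum is the variance of the integral of [g]. *)
have aoo : (\esum_(u in setT) a u < +oo)%E.
  rewrite -integral_purely_atomic//; last by move=> u; rewrite sqr_ge0.
  have := cvariance_lty _ _ _ _ _ M _ cg; rewrite VS//.
  have : (0 <= \int[S]_u (ComplexField.Normc.normc (fourier g u) ^+ 2)%:E)%E.
    by apply: integral_ge0 => u _; rewrite lee_fin sqr_ge0.
  by case: (integral _ _ _) => [s _ _| _|]; rewrite ?ltry -?/c ?gt0_muley ?lte_fin.
apply/eqP; rewrite eq_le; apply/andP; split; last first.
  apply: le_ereal_inf_tmp => _ [h _ <-].
  by rewrite /cvariance adde_ge0// variance_ge0.
apply/lee_addgt0Pr => e e0; rewrite add0e.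
(* The weights will be [|1 - exp (-i <u, t>)|^2 = 2 - 2 cos <u, t> <= 4]. *)
have [F [delta [delta0 HF]]] :=
  esum_attenuated _ _ a (e / c) 4 a0 aoo (divr_gt0 e0 c0) (ltr0n _ 4).
pose i0 := Ordinal d_gt0.
(* [A] has width at most [2 * r] along the axis [i0], so a translation by a
   positive multiple of [L] moves it off itself. *)
pose L := 2 * r + 1.
have [n [n0 nF]] := simultaneous_recurrence R _ F
  (fun u : 'rV[R]_d => - (u ord0 i0 * L)) delta delta0.
pose t : 'rV[R]_d := (n%:R * L) *: delta_mx ord0 i0.
have ut (u : 'rV[R]_d) : - \sum_(i < d) u ord0 i * t ord0 i =
    n%:R * - (u ord0 i0 * L).
  rewrite (bigD1 i0)//= big1 => [|i ii0]; last first.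
    by rewrite !mxE (negbTE ii0) andbF !mulr0.
  by rewrite !mxE !eqxx /=; ring.
have cgt := Ccb_translation _ _ g t cg.
apply: ge_ereal_inf; eexists; first exists (fun x => g (x - t)).
- split => // x Ax; apply: gA => /Ar/(_ i0); have := Ar _ Ax i0.
  rewrite !mxE !eqxx /= mulr1 !ler_norml => /andP[x1 x2] /andP[x3 x4].
  have : 1 <= n%:R :> R by rewrite ler1n.
  move: x3; rewrite /L; nra.
- reflexivity.
rewrite cvariance_RMcintB// VS; last exact: CcbB.
rewrite integral_purely_atomic//; last by move=> u; rewrite sqr_ge0.
rewrite -lee_pdivlMl// -EFinM mulrC.
rewrite (_ : (\esum_(u in setT) _)%E = (\esum_(u in [set: 'rV[R]_d])
  ((2 - 2 * cos (n%:R * - (u ord0 i0 * L)))%:E * a u))%E); last first.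
  apply: eq_esum => u _; rewrite fourier_increment// ComplexField.Normc.normcM.
  by rewrite exprMn normc_1subcexpi ut EFinM muleA.
apply: HF => // u.
have := cos_le1 (n%:R * - (u ord0 i0 * L)).
have := cos_geN1 (n%:R * - (u ord0 i0 * L)).
move=> *; apply/andP; split; lra.
Qed.
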